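(* Let $M$ be a finite set endowed with two metrics $d_0$ and $d_1$, and let $r:M\to(0,\infty)$ be a function such that for all $x,y\in M$ $$|d_0(x,y)-d_1(x,y)|\le r(x)+r(y)\quad\text{and}\quad |r(x)-r(y)|\le d_0(x,y)+d_1(x,y).$$ Suppose that the function $r(\cdot)$ is Lipschitz with respect to both metrics $d_0$ and $d_1$, that is, suppose that there exists a constant $L>0$ such that for all $x,y\in M$ $$|r(x)-r(y)|\le L\min\{d_0(x,y),d_1(x,y)\}.$$ Denote $h(x,y)=\min\{d_0(x,y),d_1(x,y)\}$ and, for $i=0,1$, $g_i(x,y)=\min\{d_i(x,y),\,r(x)+r(y)\}$. If there exist constants $C_0,C_1,C_2$ such that for $i=0,1$ $$c_1(M,g_i)\le C_i\quad\text{and}\quad c_1(M,h)\le C_2,$$ then the generalized twisted union $(M\times\mathbb{F}_2,d)$ of $(M,d_0)$ and $(M,d_1)$ with the joining function $r(\cdot)$ embeds into $L_1$ with distortion bounded above by a constant which depends only on $C_0,C_1,C_2$, and $L$.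
   Context: $\mathbb{F}_2=\{0,1\}$. $L_1$ stands for a space $L_1(\Omega,\Sigma,\mu)$, with its norm $\|\cdot\|$; embedding into $L_1$ means embedding into some such space. The distortion of a bilipschitz embedding $F$ of a metric space $X$ is $\mathrm{Lip}(F)\cdot\mathrm{Lip}(F^{-1}|_{F(X)})$, where $\mathrm{Lip}$ denotes the Lipschitz constant. Convention: for an arbitrary function $f:M\times M\to[0,\infty)$ (not necessarily a metric) and $K\ge1$, we write $c_1(M,f)\le K$ if there exists a map $\Psi:M\to L_1$ such that $f(x,y)\le\|\Psi(x)-\Psi(y)\|\le Kf(x,y)$ for all $x,y\in M$. Generalized twisted union: Let $M$ be a finite set endowed with two metrics $d_0,d_1$ and let $r:M\to(0,\infty)$ be a function such that $|d_0(x,y)-d_1(x,y)|\le r(x)+r(y)$ and $|r(x)-r(y)|\le d_0(x,y)+d_1(x,y)$ for all $x,y\in M$. The generalized twisted union of $(M,d_0)$ and $(M,d_1)$ with the joining function $r$ is the set $M\times\mathbb{F}_2$ with the metric $d$ defined as the shortest path metric of the weighted graph on $M\times\mathbb{F}_2$ with the following edges: for all $x,y\in M$, an edge between $(x,0)$ and $(y,0)$ of weight $d_0(x,y)$; for all $x,y\in M$, an edge between $(x,1)$ and $(y,1)$ of weight $d_1(x,y)$; for every $x\in M$, an edge between $(x,0)$ and $(x,1)$ of weight $r(x)$. *)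

(* Defs.v *)
From mathcomp Require Import all_boot all_order all_algebra.
From mathcomp Require Import all_classical all_reals all_analysis.

Set Implicit Arguments.
Unset Strict Implicit.
Unset Printing Implicit Defensive.

Import Order.TTheory GRing.Theory Num.Theory.
Import numFieldNormedType.Exports.

Local Open Scope classical_set_scope.
Local Open Scope ring_scope.

Definition is_metric (R : realType) (X : Type) (d : X -> X -> R) : Prop :=
  [/\ forall x y, 0 <= d x y,
      forall x y, d x y = 0 <-> x = y,
      forall x y, d x y = d y x &
      forall x y z, d x z <= d x y + d y z].

(* [LspaceType1 mu] consists of a.e.-classes; the norm of the difference is
   computed on representatives, and is finite because both of them are in L_1. *)
Definition L1_dist (R : realType) (dd : measure_display)
    (T : measurableType dd) (mu : {measure set T -> \bar R})
    (f g : LspaceType1 mu) : R :=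
  fine 'N[mu]_1[EFin \o ((f : T -> R) \- (g : T -> R))].

Section Distortion.
Variables (R : realType) (X Y : Type).

Definition lipschitz_bound (dX : X -> X -> R) (dY : Y -> Y -> R) (F : X -> Y)
    (K : R) : Prop :=
  0 <= K /\ forall x y, dY (F x) (F y) <= K * dX x y.

Definition is_lipschitz dX dY F : Prop := exists K, lipschitz_bound dX dY F K.

(* Meaningful only when [is_lipschitz dX dY F]: [inf set0 = 0]. *)
Definition Lip dX dY F : R := inf [set K | lipschitz_bound dX dY F K].

(* A preimage of [y]; it is unique, and this is F^-1 on F(X), when F is
   injective. *)
Definition range_inv (F : X -> Y) (y : range F) : X :=
  s2val (cid2 (set_valP y)).

Definition restrict_dist (A : set Y) (dY : Y -> Y -> R) (y y' : A) : R :=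
  dY (val y) (val y').

End Distortion.

Definition bilipschitz_embedding (R : realType) (X Y : Type)
    (dX : X -> X -> R) (dY : Y -> Y -> R) (F : X -> Y) : Prop :=
  [/\ injective F,
      is_lipschitz dX dY F &
      is_lipschitz (restrict_dist dY) dX (@range_inv X Y F)].

Definition distortion (R : realType) (X Y : Type)
    (dX : X -> X -> R) (dY : Y -> Y -> R) (F : X -> Y) : R :=
  Lip dX dY F * Lip (restrict_dist dY) dX (@range_inv X Y F).

Definition embeds_in_L1 (R : realType) (X : Type) (dX : X -> X -> R) (D : R)
    : Prop :=
  exists (dd : measure_display) (T : measurableType dd)
         (mu : {measure set T -> \bar R}) (F : X -> LspaceType1 mu),
    bilipschitz_embedding dX (@L1_dist R dd T mu) F /\
    distortion dX (@L1_dist R dd T mu) F <= D.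

(* c_1(M, f) <= K, for K >= 1. *)
Definition c1_le (R : realType) (M : Type) (f : M -> M -> R) (K : R) : Prop :=
  exists (dd : measure_display) (T : measurableType dd)
         (mu : {measure set T -> \bar R}) (Psi : M -> LspaceType1 mu),
    forall x y, f x y <= L1_dist (Psi x) (Psi y) <= K * f x y.

Definition walk_length (R : realType) (V : Type) (w : V -> V -> R) (u : V)
    (p : seq V) : R :=
  \sum_(e <- zip (u :: p) p) w e.1 e.2.

Definition shortest_path_dist (R : realType) (V : eqType) (edge : rel V)
    (w : V -> V -> R) (u v : V) : R :=
  inf [set walk_length w u p | p in [set p | path edge u p /\ last u p = v]].

Section TwistedUnion.
Variables (R : realType) (M : finType) (d0 d1 : M -> M -> R) (r : M -> R).

Definition tu_edge (u v : M * 'F_2) : bool := (u.2 == v.2) || (u.1 == v.1).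

(* Used only along [tu_edge]: when the second components differ, the first
   ones agree. *)
Definition tu_weight (u v : M * 'F_2) : R :=
  if u.2 == v.2 then (if u.2 == 0 then d0 u.1 v.1 else d1 u.1 v.1) else r u.1.

Definition twisted_union_dist : M * 'F_2 -> M * 'F_2 -> R :=
  shortest_path_dist tu_edge tu_weight.

End TwistedUnion.

(* Main.v *)
Require Import Defs.
From mathcomp Require Import all_boot all_order all_algebra.
From mathcomp Require Import all_classical all_reals all_analysis.
From mathcomp Require Import measurable_realfun lra.

(* An L_1 metric on a finite set is a nonnegative combination of cut metrics:
   apply this to d_0, d_1 truncated at r(x) + r(y), giving f_0, f_1, and to
   h = min(d_0, d_1), giving f_2.  For a combination f of cuts and s > 0,
   exp(-2f/s) is a mixture of kernels eps(x) eps(y) with eps = +-1 (flip the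
   sign across every cut independently), so there is a random sign that
   separates x and y with probability comparable to min(1, f/s).  Letting the
   scale s range over [r(x)/2, r(x)] yields phi_i : M -> l_1 with
   |phi_i(x)| = r(x)/2 and |phi_i(x) - phi_i(y)| comparable to
   min(d_i, r(x) + r(y)) up to an error |r(x) - r(y)| <= L h, absorbed by the
   f_2-coordinates.  The embedding is
     (x,0) |-> (f_2-coordinates, phi_0(x), 0),
     (x,1) |-> (f_2-coordinates, 0, phi_1(x)).
   Within layer i the distance is comparable to h + min(d_i, r(x) + r(y)),
   hence to d_i; across the layers it is comparable to h + r(x) + r(y).
   The upper Lipschitz bound has to be checked on edges only. *)

Import Order.TTheory GRing.Theory Num.Theory.
Local Open Scope ring_scope.

Set Implicit Arguments.
Unset Strict Implicit.
Unset Printing Implicit Defensive.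

(** * Cut decomposition of the distance |a(x) - a(y)| on a finite set *)

Section CutWeights.
Variables (R : realType) (M : finType).
Implicit Types (a : M -> R) (S : {set M}) (x y z : M).

(* The default value of the minimum dominates every difference, and keeps the
   gap integrable when [a] is a family of L_1 functions. *)
Definition cut_gap S a : R :=
  Num.max 0
    (\big[Num.min/2 * \sum_z `|a z|]_(p : M * M | (p.1 \in S) && (p.2 \notin S))
       (a p.1 - a p.2)).

Lemma cut_gap_ge0 S a : 0 <= cut_gap S a.
Proof. by rewrite le_max lexx. Qed.

Lemma cut_gap_le S a : cut_gap S a <= 2 * \sum_z `|a z|.
Proof.
by rewrite ge_max mulr_ge0 ?sumr_ge0//= bigmin_le_id.
Qed.

Lemma cut_gap_le_diff S a x y : x \in S -> y \notin S ->
  cut_gap S a <= Num.max 0 (a x - a y).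
Proof.
move=> xS yS; rewrite ge_max !le_max lexx/=; apply/orP; right.
by apply: (bigmin_le_cond _ (j := (x, y))); rewrite /= xS.
Qed.

Lemma norm_le_sum a x : `|a x| <= \sum_z `|a z|.
Proof. by rewrite (bigD1 x)//= lerDl sumr_ge0. Qed.

Lemma cut_gap_ge S a x y (c : R) : c <= a x - a y ->
  (forall u v, u \in S -> v \notin S -> c <= a u - a v) -> c <= cut_gap S a.
Proof.
move=> cxy cS; rewrite le_max; apply/orP; right; apply: le_bigmin.
  apply: (le_trans cxy).
  have := norm_le_sum a x; have := norm_le_sum a y.
  have := ler_norm (a x); have := ler_norm (- a y); rewrite normrN; lra.
by move=> p /andP[? ?]; exact: cS.
Qed.

(* Only superlevel sets of [a] have a positive gap; splitting them according to
   whether they contain a point of largest value below [a x] telescopes. *)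
Lemma sum_cut_gap a x y :
  \sum_(S : {set M} | (x \in S) && (y \notin S)) cut_gap S a
  = Num.max 0 (a x - a y).
Proof.
(* Induction on the number of points with value below [a x]. *)
have [n] := ubnP #|[set u | (a u < a x)%R]|.
elim: n x => // n IH x lex.
have [axy|ayx] := leP (a x) (a y).
  rewrite big1 => [|S /andP[xS yS]].
    by apply/esym/max_idPl; rewrite subr_le0.
  apply/eqP; rewrite eq_le cut_gap_ge0 andbT.
  apply: (le_trans (cut_gap_le_diff _ xS yS)).
  by rewrite ge_max lexx subr_le0.
have [z azx zmax] : exists2 z, a z < a x & forall u, a u < a x -> a u <= a z.
  case: (@Order.TotalTheory.arg_maxP _ R M y (fun u => a u < a x) a ayx) => z.
  by exists z.
have ayz := zmax _ ayx.
rewrite (bigID (fun S : {set M} => z \in S))/=.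
have IHz : (#|[set u | (a u < a z)%R]| < n)%N.
  rewrite -ltnS; apply: leq_trans lex; rewrite ltnS.
  apply/proper_card/properP; split.
    by apply/fintype.subsetP => u; rewrite !inE => /lt_trans; apply.
  by exists z; rewrite !inE ?azx ?ltxx.
have -> : \sum_(S : {set M} | (x \in S) && (y \notin S) && (z \in S)) cut_gap S a
   = Num.max 0 (a z - a y).
  (* Sets that contain z but not x have gap zero because [a z < a x], so they may be added to
     complete the sum for z. *)
  rewrite -(IH z IHz) [RHS](bigID (fun S : {set M} => x \in S))/=.
  rewrite [X in _ = _ + X]big1 ?addr0.
    by apply: eq_bigl => S; rewrite andbC andbA andbAC.
  move=> S /andP[/andP[zS yS] xS].
  apply/eqP; rewrite eq_le cut_gap_ge0 andbT.
  apply: (le_trans (cut_gap_le_diff _ zS xS)).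
  by rewrite ge_max lexx subr_le0 ltW.
(* Among the sets containing x but not z, only this superlevel set has a positive gap: any other one
   has a member of value at most [a z], or omits a point of value at least [a x]. *)
pose S0 := [set u | a x <= a u].
rewrite (bigD1 S0)/=; last by rewrite !inE lexx/= -!ltNge ayx azx.
rewrite [X in _ + (_ + X)]big1 ?addr0; last first.
  move=> S /andP[/andP[/andP[xS yS] zS]] SS0.
  have [u uP] : exists u,
      ((u \in S) && (a u < a x)) || ((u \notin S) && (a x <= a u)).
    apply/existsP; apply: contraR SS0; rewrite negb_exists => /forallP H.
    apply/eqP/setP => u; rewrite inE.
    by have := H u; rewrite ltNge; case: (u \in S); case: (a x <= a u).
  apply/eqP; rewrite eq_le cut_gap_ge0 andbT.
  case/orP: uP => /andP[uS au].
    apply: (le_trans (cut_gap_le_diff _ uS zS)).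
    by rewrite ge_max lexx subr_le0 zmax.
  apply: (le_trans (cut_gap_le_diff _ xS uS)).
  by rewrite ge_max lexx subr_le0.
have -> : cut_gap S0 a = a x - a z.
  apply/eqP; rewrite eq_le; apply/andP; split.
    apply: (le_trans (@cut_gap_le_diff S0 a x z _ _)).
    - by rewrite inE.
    - by rewrite inE -ltNge.
    - by rewrite ge_max lexx subr_ge0 ltW.
  apply: (@cut_gap_ge _ _ x z) => // u v; rewrite !inE -ltNge => au /zmax av.
  lra.
have -> : Num.max 0 (a z - a y) = a z - a y by apply/max_idPr; rewrite subr_ge0.
have -> : Num.max 0 (a x - a y) = a x - a y by apply/max_idPr; rewrite subr_ge0 ltW.
lra.
Qed.

Definition cut_dist (w : {set M} -> R) x y : R :=
  \sum_(S : {set M}) w S * ((x \in S) != (y \in S))%:R.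

(** The positive and negative parts of a(x) - a(y) are carried by the cuts with x inside and y
    outside, and by those with y inside and x outside. *)
Lemma cut_dist_gap a x y : cut_dist (cut_gap ^~ a) x y = `|a x - a y|.
Proof.
have -> : `|a x - a y| = Num.max 0 (a x - a y) + Num.max 0 (a y - a x).
  have [axy|/ltW axy] := leP (a x) (a y).
    by rewrite ler0_norm ?subr_le0// !maxEle !subr_ge0 axy;
      case: leP => ?; lra.
  by rewrite ger0_norm ?subr_ge0// !maxEle !subr_ge0 axy; case: leP => ?; lra.
rewrite -!sum_cut_gap big_mkcond [X in _ + X]big_mkcond -big_split/=.
apply: eq_bigr => S _.
by case: (x \in S); case: (y \in S); rewrite /= ?mulr1 ?mulr0 ?addr0 ?add0r.
Qed.

End CutWeights.

(** * From L_1 distances to nonnegative combinations of cuts *)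

Section L1ToCuts.
Variable R : realType.

Lemma measurable_bigminr (dd : measure_display) (T : measurableType dd)
    (I : Type) (s : seq I) (P : pred I) (b : T -> R) (f : I -> T -> R) :
  measurable_fun setT b -> (forall i, measurable_fun setT (f i)) ->
  measurable_fun setT (fun t => \big[Num.min/b t]_(i <- s | P i) f i t).
Proof.
move=> mb mf; elim: s => [|i s IH].
  by under eq_fun do rewrite big_nil.
under eq_fun do rewrite big_cons.
by case: (P i) => //; exact: measurable_minr.
Qed.

Lemma LspaceType1_integrable (dd : measure_display) (T : measurableType dd)
    (mu : {measure set T -> \bar R}) (f : LspaceType1 mu) :
  mu.-integrable setT (EFin \o (f : T -> R)).
Proof.
apply/Lfun1_integrable; rewrite inE; apply/andP; split; rewrite inE/=.
  exact: (@measurable_funPT _ _ T (measurableTypeR R) (repr (LebesgueSpace.sort f))).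
exact: Lebesgue_finite.
Qed.

Lemma cut_gap_integrable (M : finType) (dd : measure_display)
    (T : measurableType dd) (mu : {measure set T -> \bar R})
    (a : M -> T -> R) (S : {set M}) :
  (forall z, mu.-integrable setT (EFin \o a z)) ->
  mu.-integrable setT (EFin \o (fun t => cut_gap S (a ^~ t))).
Proof.
move=> ia.
have ma z : measurable_fun setT (a z).
  exact/measurable_EFinP/(measurable_int mu).
have ib : mu.-integrable setT (fun t => 2%:E * \sum_z `|(EFin \o a z) t|)%E.
  apply: integrableZl => //; apply: integrable_sum => // z _.
  exact: integrable_abse.
have bE t : (2%:E * \sum_z `|(EFin \o a z) t|)%E = (2 * \sum_z `|a z t|)%:E.
  by rewrite EFinM -sumEFin; congr (_ * _)%E; apply: eq_bigr.
apply: (le_integrable _ _ _ ib) => //.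
- apply/measurable_EFinP; apply: measurable_maxr => //.
  apply: measurable_bigminr => [|p]; last exact: measurable_funB.
  apply/measurable_EFinP; under [_ \o _]eq_fun do rewrite /= -bE.
  exact: (measurable_int mu).
- move=> t _; rewrite bE /= lee_fin ger0_norm ?cut_gap_ge0// ger0_norm.
    exact: cut_gap_le.
  by rewrite mulr_ge0// sumr_ge0.
Qed.

(** At each point t the values of the functions [Psi z] decompose into cuts; the integrals over t of
    the gaps are weights that reproduce the L_1 distance exactly. *)
Lemma c1_le_cut_dist (M : finType) (f : M -> M -> R) (K : R) : c1_le f K ->
  exists2 w : {set M} -> R, forall S, 0 <= w S &
    forall x y, f x y <= cut_dist w x y <= K * f x y.
Proof.
move=> [dd [T [mu [Psi PsiP]]]].
pose a z t := (Psi z : T -> R) t.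
have ia z : mu.-integrable setT (EFin \o a z) by exact: LspaceType1_integrable.
have ig S := cut_gap_integrable S ia.
exists (fun S => fine (\int[mu]_t (cut_gap S (a ^~ t))%:E)%E) => [S|x y].
  by rewrite fine_ge0// integral_ge0// => t _; rewrite lee_fin cut_gap_ge0.
suff <- : L1_dist (Psi x) (Psi y) =
  cut_dist (fun S => fine (\int[mu]_t (cut_gap S (a ^~ t))%:E)%E) x y by [].
rewrite /L1_dist Lnorm1.
transitivity (fine (\int[mu]_t
   \sum_(S : {set M}) (((x \in S) != (y \in S))%:R%:E * (cut_gap S (a ^~ t))%:E))%E).
  congr fine; apply: eq_integral => t _.
  rewrite /= -/(a x t) -/(a y t) -(cut_dist_gap (a ^~ t)) /cut_dist -sumEFin.
  by apply: eq_bigr => S _; rewrite EFinM muleC.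
rewrite integral_sum//; last first.
  by move=> S; exact: (integrableZl _ _ (ig S)).
rewrite -sum_fine.
  apply: eq_bigr => S _; rewrite (integralZl _ (ig S))// fineM//.
    by rewrite mulrC.
  exact: (integrable_fin_num _ (ig S)).
move=> S _; apply: integrable_fin_num => //.
exact: (integrableZl _ _ (ig S)).
Qed.

End L1ToCuts.

(** * Random signs with prescribed correlations, and the partition into scales *)

Section SignMixtures.
Variables (R : realType) (M : finType).

(** A finite probability distribution on sign functions, each encoded by the set where it is -1;
    [K x y] is the expected product of the signs at x and y. *)
Definition sign_mixture (K : M -> M -> R) : Prop :=
  exists s : seq (R * {set M}),
    [/\ all (fun p => 0 <= p.1) s, \sum_(p <- s) p.1 = 1 &
        forall x y,
          K x y = \sum_(p <- s) p.1 * (-1) ^+ ((x \in p.2) (+) (y \in p.2))].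

Lemma sign_mixture1 : sign_mixture (fun _ _ => 1).
Proof.
exists [:: (1, finset.set0)]; split => [||x y]; first by rewrite /= ler01.
  by rewrite big_seq1.
by rewrite big_seq1 /= !inE expr0 mulr1.
Qed.

(** Multiply independent signs: the negative set of a product is the symmetric difference. *)
Lemma sign_mixtureM K1 K2 : sign_mixture K1 -> sign_mixture K2 ->
  sign_mixture (fun x y => K1 x y * K2 x y).
Proof.
move=> [s1 [s1ge s1E K1E]] [s2 [s2ge s2E K2E]].
exists [seq (p.1 * q.1, [set x | (x \in p.2) (+) (x \in q.2)]) |
          p : R * {set M} <- s1, q : R * {set M} <- s2]; split.
- apply/all_allpairsP => p q ps qs /=.
  by rewrite mulr_ge0// ?(allP s1ge _ ps) ?(allP s2ge _ qs).
- rewrite big_allpairs_dep/= -[RHS]s1E; apply: eq_bigr => p _.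
  by rewrite -mulr_sumr s2E mulr1.
- move=> x y; rewrite K1E K2E big_allpairs_dep/= mulr_suml.
  apply: eq_bigr => p _; rewrite mulr_sumr; apply: eq_bigr => q _.
  rewrite mulrACA -signr_addb !inE; congr (_ * (-1) ^+ nat_of_bool _).
  by rewrite addbACA.
Qed.

(** The sign is flipped on S with probability (1 - exp(-b)) / 2, so the correlation across the cut
    is exp(-b). *)
Lemma sign_mixture_cut (S : {set M}) (b : R) : 0 <= b ->
  sign_mixture (fun x y => expR (- (b * ((x \in S) != (y \in S))%:R))).
Proof.
move=> b0; have e0 := expR_gt0 (- b).
have e1 : expR (- b) <= 1 by rewrite expR_le1 oppr_le0.
exists [:: ((1 + expR (- b)) / 2, finset.set0);
           ((1 - expR (- b)) / 2, S)]; split => [||x y].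
- by rewrite /= andbT; apply/andP; split; lra.
- by rewrite big_cons big_seq1/=; lra.
- rewrite big_cons big_seq1/= !inE expr0 mulr1.
  by case: (x \in S); case: (y \in S);
    rewrite /= ?mulr0 ?mulr1 ?oppr0 ?expR0 ?expr0 ?expr1; lra.
Qed.

Lemma sign_mixture_expR_cut_dist (w : {set M} -> R) : (forall S, 0 <= w S) ->
  sign_mixture (fun x y => expR (- cut_dist w x y)).
Proof.
move=> w0; rewrite /cut_dist.
elim: (index_enum _) => [|S s IH].
  under eq_fun do under eq_fun do rewrite big_nil oppr0 expR0.
  exact: sign_mixture1.
under eq_fun do under eq_fun do rewrite big_cons opprD expRD.
by apply: sign_mixtureM => //; exact: sign_mixture_cut.
Qed.

(** Each sign function, multiplied by [a] and by its probability, is one coordinate. Signs agree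
    with probability (1 + K) / 2, contributing |a(x) - a(y)|, and otherwise contribute a(x) +
    a(y). *)
Lemma sign_mixture_l1 (K : M -> M -> R) (a : M -> R) :
  sign_mixture K -> (forall x, 0 <= a x) ->
  exists s : seq (M -> R), (forall x, \sum_(u <- s) `|u x| = a x) /\
    forall x y, \sum_(u <- s) `|u x - u y|
      = (1 + K x y) / 2 * `|a x - a y| + (1 - K x y) / 2 * (a x + a y).
Proof.
move=> [s [s0 s1 KE]] a0.
exists [seq (fun x => p.1 * ((-1) ^+ (x \in p.2) * a x)) |
          p : R * {set M} <- s]; split => [x|x y].
  transitivity (\sum_(p <- s) p.1 * a x); last by rewrite -mulr_suml s1 mul1r.
  rewrite big_map !big_seq; apply: eq_bigr => p ps.
  by rewrite normrM normrMsign !ger0_norm// (allP s0).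
rewrite big_map KE.
transitivity (\sum_(p <- s) (p.1 * ((`|a x - a y| + (a x + a y)) / 2) +
    p.1 * (-1) ^+ ((x \in p.2) (+) (y \in p.2))
      * ((`|a x - a y| - (a x + a y)) / 2))).
  rewrite !big_seq; apply: eq_bigr => p ps.
  rewrite -mulrBr normrM ger0_norm ?(allP s0)// -mulrA -mulrDr; congr (_ * _).
  have axy : 0 <= a x + a y by rewrite addr_ge0.
  case: (x \in p.2); case: (y \in p.2);
    rewrite /= ?expr0 ?expr1 ?mul1r ?mulN1r ?opprK.
  - by rewrite [- a x + a y]addrC distrC; lra.
  - by rewrite -opprD normrN ger0_norm//; lra.
  - by rewrite ger0_norm//; lra.
  - by lra.
rewrite big_split/= -!mulr_suml s1; lra.
Qed.

(** [F] is arbitrary so that the splitting serves both norms and distances. *)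
Lemma l1_direct_sum (N : nat) (P : 'I_N -> seq (M -> R) -> Prop) :
  (forall k, exists s, P k s) ->
  exists s : 'I_N -> seq (M -> R), (forall k, P k (s k)) /\
    forall F : (M -> R) -> R, \sum_(u <- flatten [seq s k | k : 'I_N]) F u
      = \sum_k \sum_(u <- s k) F u.
Proof.
move=> /choice[s sP]; exists s; split => // F.
by rewrite big_flatten big_image.
Qed.

(* [w k] measures the part of [[r x / 2, r x]] in the k-th of [N] consecutive
   intervals of length [delta <= r x], and [sc k] is the right end of that
   interval. *)
Lemma scale_partition (r : M -> R) : (forall x, 0 < r x) ->
  exists (N : nat) (w : 'I_N -> M -> R) (sc : 'I_N -> R),
  [/\ forall k x, 0 <= w k x, forall k, 0 < sc k,
      forall x, \sum_k w k x = r x / 2,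
      forall x y, \sum_k `|w k x - w k y| <= 3 / 2 * `|r x - r y| &
      forall k x, w k x != 0 -> r x / 2 <= sc k <= 2 * r x].
Proof.
move=> r0.
(* The default 1 keeps [delta] positive when [M] is empty. *)
pose delta := \big[Num.min/1]_x r x.
have d0 : 0 < delta by apply: lt_bigmin => // x _; exact: r0.
have dr x : delta <= r x by exact: bigmin_le.
pose N := (Num.trunc ((\sum_x r x) / delta)).+1.
have rN x : r x <= N%:R * delta.
  rewrite -ler_pdivrMr//; apply: le_trans (ltW (truncnS_gt _)).
  rewrite ler_pM2r ?invr_gt0// (bigD1 x)//= lerDl sumr_ge0// => y _.
  exact/ltW/r0.
(* For c >= 0 this is the length of the part of [0, c] in the k-th interval. *)
pose v (k : nat) (c : R) := Num.min c (k.+1%:R * delta) - Num.min c (k%:R * delta).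
have kd (k : nat) : k.+1%:R * delta = k%:R * delta + delta.
  by rewrite -[in LHS]addn1 natrD mulrDl mul1r.
have kd0 (k : nat) : 0 <= k%:R * delta by rewrite mulr_ge0// ltW.
have vmono k c c' : c <= c' -> v k c <= v k c'.
  rewrite /v kd => cc'; have := kd0 k; move: (k%:R * delta) => t t0.
  by case: (leP c (t + delta)) => ?; case: (leP c t) => ?;
    case: (leP c' (t + delta)) => ?; case: (leP c' t) => ?; lra.
have sumv c : 0 <= c -> c <= N%:R * delta -> \sum_(k < N) v k c = c.
  move=> c0 cN; rewrite /v.
  rewrite -(big_mkord xpredT (fun k => v k c)).
  rewrite (telescope_sumr_eq (fun k => Num.min c (k%:R * delta)))//.
  by rewrite mul0r (min_idPl cN) (min_idPr c0) subr0.
(* The interval then meets [c/2, c], so its right end is at least c/2 and at most c + delta <=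
   2c. *)
have vsupp k c : 0 < c -> delta <= c -> v k c - v k (c / 2) != 0 ->
    c / 2 <= k.+1%:R * delta <= 2 * c.
  rewrite /v kd; have := kd0 k; move: (k%:R * delta) => t t0 c0 dc.
  have [tc|tc] := leP c t; first by rewrite !(min_idPl _) ?subrr ?eqxx; lra.
  have [tc2|tc2] := leP (t + delta) (c / 2); last first.
    by move=> _; apply/andP; split; lra.
  by rewrite !(min_idPr _) ?subrr ?eqxx//; lra.
clearbody v.
have r20 x : 0 <= r x / 2 by rewrite divr_ge0// ltW.
have r2 x : r x / 2 <= r x by have := r0 x; lra.
have r2N x : r x / 2 <= N%:R * delta := le_trans (r2 x) (rN x).
exists N, (fun k x => v k (r x) - v k (r x / 2)), (fun k => k.+1%:R * delta).
split.
- by move=> k x; rewrite subr_ge0 vmono.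
- by move=> k; rewrite mulr_gt0.
- by move=> x; have := r0 x; rewrite /= sumrB !sumv ?(ltW (r0 x))//; lra.
- move=> x y; wlog rxy : x y / r y <= r x => [wlg|].
    have [/wlg//|/ltW/wlg] := leP (r y) (r x).
    by rewrite [`|r y - r x|]distrC; under eq_bigr do rewrite distrC.
  have rxy2 : r y / 2 <= r x / 2 by lra.
  (* By monotonicity of [v k] the increments at both ends of the range are nonnegative; they sum to
     r(x) - r(y) and to half of it, whence 3/2. *)
  apply: (@le_trans _ _ (\sum_(k < N) ((v k (r x) - v k (r y)) +
      (v k (r x / 2) - v k (r y / 2))))).
    apply: ler_sum => k _; rewrite ler_norml.
    by have := vmono k _ _ rxy; have := vmono k _ _ rxy2 => *; lra.
  rewrite big_split/= !sumrB !sumv// ?(ltW (r0 _))// ger0_norm ?subr_ge0//; lra.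
- by move=> k x; exact: vsupp.
Qed.

End SignMixtures.

(** * Truncating a cut metric at r(x) + r(y) inside l_1 *)

Section Truncation.
Variables (R : realType) (M : finType).

(** Both halves come from exp(s) >= 1 + s; the lower one through 1 - exp(-t) >= t / (1 + t) >=
    min(1, t) / 2. *)
Lemma one_sub_expRN_bounds (t : R) : 0 <= t ->
  Num.min 1 t / 2 <= 1 - expR (- t) <= t.
Proof.
move=> t0; apply/andP; split; last by have := expR_ge1Dx (- t); lra.
have e1 : expR (- t) <= (1 + t)^-1.
  by rewrite expRN lef_pV2 ?posrE ?expR_gt0 ?expR_ge1Dx//; lra.
apply: (@le_trans _ _ (1 - (1 + t)^-1)); last by lra.
have t1 : (1 + t) * (1 + t)^-1 = 1 by rewrite divff//; lra.
have i0 : 0 < (1 + t)^-1 by rewrite invr_gt0; lra.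
move: (1 + t)^-1 t1 i0 => i t1 i0.
have [t1'|t1'] := leP 1 t.
  have : 0 <= i * (t - 1) by rewrite mulr_ge0 ?subr_ge0// ltW.
  lra.
have i1 : 0 <= i * (1 - t) by rewrite mulr_ge0 ?subr_ge0 ?ltW.
have : 0 <= t * (2 * i - 1) by rewrite mulr_ge0//; lra.
lra.
Qed.

Lemma truncated_l1 (w : {set M} -> R) (r : M -> R) :
  (forall S, 0 <= w S) -> (forall x, 0 < r x) ->
  exists s : seq (M -> R), (forall x, \sum_(u <- s) `|u x| = r x / 2) /\
    forall x y, Num.min (r x + r y) (cut_dist w x y) / 8
      <= \sum_(u <- s) `|u x - u y|
      <= 3 / 2 * `|r x - r y| + 2 * cut_dist w x y.
Proof.
move=> w0 r0.
have [N [a [sc [a0 sc0 suma suma_diff scP]]]] := scale_partition r0.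
pose K k x y := expR (- (2 / sc k * cut_dist w x y)).
have KP k : sign_mixture (K k).
  rewrite /K; have w'0 S : 0 <= 2 / sc k * w S.
    by rewrite mulr_ge0// divr_ge0// ltW.
  have -> : (fun x y => expR (- (2 / sc k * cut_dist w x y))) =
      (fun x y => expR (- cut_dist (fun S => 2 / sc k * w S) x y)).
    apply/funext => x; apply/funext => y; congr (expR (- _)).
    by rewrite /cut_dist mulr_sumr; apply: eq_bigr => S _; rewrite mulrA.
  exact: sign_mixture_expR_cut_dist.
have [s [sP sumsE]] := l1_direct_sum (fun k => sign_mixture_l1 (KP k) (a0 k)).
exists (flatten [seq s k | k : 'I_N]); split => [x|x y].
  by rewrite sumsE -suma; apply: eq_bigr => k _; exact: (sP k).1.
rewrite sumsE; set f := cut_dist w x y.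
have f0 : 0 <= f by apply: sumr_ge0 => S _; rewrite mulr_ge0.
have t0 k : 0 <= 2 / sc k * f by rewrite mulr_ge0// divr_ge0// ltW.
(* Where the weight is nonzero, [sc k <= 2 * r z] makes the exponent 2f / [sc k] at least f /
   r(z). *)
have lower z k : a k z * (Num.min 1 (f / r z) / 2) <= (1 - K k x y) * a k z.
  have [->|az] := eqVneq (a k z) 0; first by rewrite mul0r mulr0.
  rewrite mulrC ler_wpM2r// /K.
  have /andP[+ _] := one_sub_expRN_bounds (t0 k); apply: le_trans.
  rewrite ler_pM2r//; apply: le_min2 => //.
  rewrite mulrC ler_wpM2r// ler_pdivlMr// ler_pdivrMl//.
  by have /andP[_] := scP _ _ az; lra.
(* Here [sc k >= r x / 2] bounds the exponent by 4f / r(x). *)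
have upper k : (1 - K k x y) * a k x <= 4 * f / r x * a k x.
  have [->|az] := eqVneq (a k x) 0; first by rewrite !mulr0.
  rewrite ler_wpM2r//.
  have /andP[_] := one_sub_expRN_bounds (t0 k); move=> /le_trans; apply.
  rewrite [4 * f / _]mulrAC ler_wpM2r//.
  rewrite ler_pdivrMr// mulrAC ler_pdivlMr//.
  by have /andP[+ _] := scP _ _ az; lra.
have min_scale z : r z * Num.min 1 (f / r z) = Num.min (r z) f.
  by rewrite minr_pMr ?ltW// mulr1 mulrC divfK// gt_eqF.
have fr z : 4 * f / r z * (r z / 2) = 2 * f.
  by rewrite mulrA divfK ?gt_eqF//; lra.
apply/andP; split.
(* The term with |a(x) - a(y)| is dropped. The weights at x sum to r(x) / 2, giving min(r(x), f) /
   8, and likewise at y; these two minima dominate the joint one. *)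
- apply: (@le_trans _ _ (\sum_k (a k x * (Num.min 1 (f / r x) / 4)
    + a k y * (Num.min 1 (f / r y) / 4)))).
    rewrite big_split/= -!mulr_suml !suma.
    have := min_scale x; have := min_scale y.
    move: (Num.min 1 _) => m1; move: (Num.min 1 _) => m2 e1 e2.
    have : Num.min (r x + r y) f <= Num.min (r x) f + Num.min (r y) f.
      have := r0 x; have := r0 y.
      by case: (leP (r x) f); case: (leP (r y) f); case: (leP (r x + r y) f); lra.
    by rewrite -e1 -e2; lra.
  apply: ler_sum => k _; rewrite (sP k).2.
  have := lower x k; have := lower y k; have := a0 k x; have := a0 k y.
  have K1 : 0 <= 1 + K k x y by rewrite addr_ge0// expR_ge0.
  have := mulr_ge0 K1 (normr_ge0 (a k x - a k y)).
  lra.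
(* Replacing a(y) by a(x) + |a(x) - a(y)| leaves |a(x) - a(y)| + (1 - K) a(x) at each scale. *)
- apply: (@le_trans _ _ (\sum_k (`|a k x - a k y| + 4 * f / r x * a k x))).
    apply: ler_sum => k _; rewrite (sP k).2.
    apply: le_trans (lerD (lexx _) (upper k)).
    have K1 : 0 <= 1 - K k x y.
      by rewrite subr_ge0 /K expR_le1 oppr_le0.
    have : a k y <= a k x + `|a k x - a k y|.
      by have := ler_norm (a k y - a k x); rewrite distrC; lra.
    nra.
  by rewrite big_split/= -mulr_sumr suma fr lerD2r.
Qed.

End Truncation.

(** * Finite-dimensional l_1 as an L_1 space *)

Section FiniteL1.
Variables (R : realType) (N : nat).

(** Counting measure on the first N naturals, extended by zero to all of them. *)
Let mu : {measure set nat -> \bar R} := msum (fun n => \d_n) N.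

Lemma integral_sum_dirac (f : nat -> R) :
  (\int[mu]_t `|f t|%:E)%E = (\sum_(n < N) `|f n|)%:E.
Proof.
rewrite ge0_integral_measure_sum//.
rewrite -sumEFin; apply: eq_bigr => n _.
by rewrite integral_dirac// diracT mul1e.
Qed.

(** Elements are classes modulo a.e. equality, so the chosen representative is only known to agree
    with [f] almost everywhere. *)
Lemma LspaceType1_of_fun (f : nat -> R) :
  exists F : LspaceType1 mu, {ae mu, forall t, (F : nat -> R) t = f t}.
Proof.
have mf : @measurable_fun _ _ nat (measurableTypeR R) setT f by move=> ? Y mY.
pose g : {mfun nat >-> measurableTypeR R} :=
  @mfun_Sub _ _ nat (measurableTypeR R) f (mem_set mf).
pose q : {mfun_ mu, nat >-> measurableTypeR R} :=
  (\pi_({mfun_ mu, nat >-> measurableTypeR R}) g)%qT.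
have qE : {ae mu, forall t, repr q t = f t}.
  have /eqmodP/asboolP := reprK q.
  by apply: filterS => t /(_ I).
have q1 : finite_norm mu 1 q.
  rewrite /finite_norm Lnorm1.
  rewrite (@ae_eq_integral _ _ _ mu setT (fun t => `|f t|%:E))//.
    by rewrite integral_sum_dirac ltry.
  by apply: filterS qE => t <- _.
pose c := isFinLebesgue.Build _ _ _ mu _ (lexx 1%E) q q1.
by exists (LebesgueSpace.Pack (LebesgueSpace.Class c)).
Qed.

Lemma l1_in_LspaceType1 (V : Type) (f : V -> nat -> R) :
  exists F : V -> LspaceType1 mu,
    forall u v, L1_dist (F u) (F v) = \sum_(n < N) `|f u n - f v n|.
Proof.
have /choice[F FE] := fun v => LspaceType1_of_fun (f v).
exists F => u v; rewrite /L1_dist Lnorm1.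
rewrite (@ae_eq_integral _ _ _ mu setT (fun t => `|f u t - f v t|%:E))//.
  by rewrite integral_sum_dirac.
by apply: filterS2 (FE u) (FE v) => t /= -> -> _.
Qed.

End FiniteL1.

(** * Distortion from two-sided estimates *)

Section Bilipschitz.
Variables (R : realType) (X Y : Type) (dX : X -> X -> R) (dY : Y -> Y -> R).

Lemma Lip_ge0 (F : X -> Y) : 0 <= Lip dX dY F.
Proof.
rewrite /Lip.
have [->|/set0P neq0] := eqVneq [set K | lipschitz_bound dX dY F K]%classic set0.
  by rewrite inf0.
by apply: lb_le_inf => // K [].
Qed.

Lemma Lip_le (F : X -> Y) (K : R) : lipschitz_bound dX dY F K ->
  Lip dX dY F <= K.
Proof. by move=> ?; apply: ge_inf => //; exists 0 => ? []. Qed.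

Lemma range_invK (F : X -> Y) (y : range F) : F (range_inv y) = val y.
Proof. by rewrite /range_inv; case: cid2. Qed.

End Bilipschitz.

(** Injectivity is assumed separately because [dX] and [dY] are arbitrary functions here. *)
Lemma bilipschitz_distortion (R : realType) (X Y : Type) (dX : X -> X -> R)
    (dY : Y -> Y -> R) (F : X -> Y) (A B : R) :
  0 < A -> 0 <= B -> injective F ->
  (forall x y, A * dX x y <= dY (F x) (F y) <= B * dX x y) ->
  bilipschitz_embedding dX dY F /\ distortion dX dY F <= B / A.
Proof.
move=> A0 B0 injF FP.
have lF : lipschitz_bound dX dY F B.
  by split => // x y; have /andP[] := FP x y.
have lFi : lipschitz_bound (restrict_dist dY) dX (@range_inv X Y F) A^-1.
  split => [|y y']; first by rewrite invr_ge0 ltW.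
  rewrite ler_pdivlMl// /restrict_dist -!range_invK.
  by have /andP[] := FP (range_inv y) (range_inv y').
split; first by split => //; [exists B | exists A^-1].
by apply: ler_pM; rewrite ?Lip_ge0 ?Lip_le.
Qed.

Lemma embeds_in_L1_of_seq (R : realType) (V : Type) (d : V -> V -> R)
    (s : seq (V -> R)) (A B : R) : 0 < A -> 0 <= B ->
  (forall u v, \sum_(f <- s) `|f u - f v| = 0 -> u = v) ->
  (forall u v, A * d u v <= \sum_(f <- s) `|f u - f v| <= B * d u v) ->
  embeds_in_L1 d (B / A).
Proof.
move=> A0 B0 sinj sP.
have [F FE] := l1_in_LspaceType1 (size s) (fun (u : V) n => nth (fun=> 0) s n u).
have {}FE u v : L1_dist (F u) (F v) = \sum_(f <- s) `|f u - f v|.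
  by rewrite FE (big_nth (fun=> 0)) big_mkord.
eexists _, _, _, F; apply: bilipschitz_distortion => // [u v Fuv|u v].
  apply: sinj; rewrite -FE Fuv FE; apply: big1 => f _.
  by rewrite subrr normr0.
by rewrite FE.
Qed.

(** * Estimates for shortest path distances *)

Section ShortestPaths.
Variables (R : realType) (V : eqType) (edge : rel V) (w : V -> V -> R).
Hypothesis w_ge0 : forall u v, 0 <= w u v.

Lemma walk_length_cons u v p :
  walk_length w u (v :: p) = w u v + walk_length w v p.
Proof. by rewrite /walk_length /= big_cons. Qed.

Lemma walk_length_nil u : walk_length w u [::] = 0.
Proof. by rewrite /walk_length /= big_nil. Qed.

Lemma shortest_path_dist_le u v p : path edge u p -> last u p = v ->
  shortest_path_dist edge w u v <= walk_length w u p.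
Proof.
move=> up lp; apply: ge_inf; last by exists p.
by exists 0 => _ [q _ <-]; exact: sumr_ge0.
Qed.

(** The bound on edges adds up along any walk by the triangle inequality for [rho]; a connecting
    walk keeps the infimum from being over the empty set. *)
Lemma le_shortest_path_dist (rho : V -> V -> R) (B : R) u v : 0 < B ->
  (forall a, rho a a = 0) -> (forall a b c, rho a c <= rho a b + rho b c) ->
  (forall a b, edge a b -> rho a b <= B * w a b) ->
  (exists2 p, path edge u p & last u p = v) ->
  rho u v <= B * shortest_path_dist edge w u v.
Proof.
move=> B0 rho0 rhoD rhow [p0 up0 lp0]; rewrite -ler_pdivrMl//.
apply: lb_le_inf; first by exists (walk_length w u p0), p0.
move=> _ [p [up lp] <-]; rewrite ler_pdivrMl// -lp {lp up0 lp0}.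
elim: p u up => [|b p IH] u /=; first by rewrite rho0 walk_length_nil mulr0.
move=> /andP[ub bp]; rewrite walk_length_cons mulrDr.
by apply: le_trans (rhoD u b _) _; rewrite lerD ?rhow ?IH.
Qed.

End ShortestPaths.

Lemma eq_F2 (i j : 'F_2) : (i == j) = ((i == 0) == (j == 0)).
Proof. by case: i => [[|[|//]] ?]; case: j => [[|[|//]] ?]. Qed.

(** * Coordinates of the embedding *)

Section TwistedUnionEmbedding.
Variables (R : realType) (M : finType) (w2 : {set M} -> R).
Variables (r : M -> R) (t0 t1 : seq (M -> R)).

Definition tu_coords : seq (M * 'F_2 -> R) :=
  [seq (fun u => w2 A * (u.1 \in A)%:R) | A : {set M}] ++
  [seq (fun u => f u.1 * (u.2 == 0)%:R) | f : M -> R <- t0] ++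
  [seq (fun u => f u.1 * (u.2 != 0)%:R) | f : M -> R <- t1].

Definition tu_rho (u v : M * 'F_2) : R := \sum_(f <- tu_coords) `|f u - f v|.

Lemma tu_rho0 u : tu_rho u u = 0.
Proof. by apply: big1 => f _; rewrite subrr normr0. Qed.

Lemma tu_rhoD u v z : tu_rho u z <= tu_rho u v + tu_rho v z.
Proof. by rewrite -big_split; apply: ler_sum => f _; exact: ler_distD. Qed.

Hypothesis w2_ge0 : forall S, 0 <= w2 S.
Hypothesis t0r : forall x, \sum_(f <- t0) `|f x| = r x / 2.
Hypothesis t1r : forall x, \sum_(f <- t1) `|f x| = r x / 2.

(** The [t0] and [t1] blocks live on different layers: within a layer one block vanishes, and across
    layers each contributes the norm of a single point. *)
Lemma tu_rhoE u v : tu_rho u v = cut_dist w2 u.1 v.1 +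
  if u.2 == v.2 then
    \sum_(f <- if u.2 == 0 then t0 else t1) `|f u.1 - f v.1|
  else r u.1 / 2 + r v.1 / 2.
Proof.
rewrite /tu_rho !big_cat big_image !big_map /=; congr (_ + _).
  apply: eq_bigr => A _; rewrite -mulrBr normrM ger0_norm//; congr (_ * _).
  by case: (_ \in _); case: (_ \in _);
    rewrite /= ?subrr ?normr0 ?subr0 ?sub0r ?normrN ?normr1.
rewrite eq_F2; case: (u.2 == 0); case: (v.2 == 0) => /=.
- rewrite [X in _ + X]big1 ?addr0 => [|f _]; last by rewrite !mulr0 subr0 normr0.
  by apply: eq_bigr => f _; rewrite !mulr1.
- rewrite -t0r -t1r; congr (_ + _); apply: eq_bigr => f _.
    by rewrite mulr1 mulr0 subr0.
  by rewrite mulr1 mulr0 sub0r normrN.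
- rewrite [RHS]addrC -t0r -t1r; congr (_ + _); apply: eq_bigr => f _.
    by rewrite mulr1 mulr0 sub0r normrN.
  by rewrite mulr1 mulr0 subr0.
- rewrite [X in X + _]big1 ?add0r => [|f _]; last by rewrite !mulr0 subr0 normr0.
  by apply: eq_bigr => f _; rewrite !mulr1.
Qed.

End TwistedUnionEmbedding.

(** * Upper bounds for the twisted union metric *)

Section TwistedUnionBounds.
Variables (R : realType) (M : finType) (d0 d1 : M -> M -> R) (r : M -> R).
Hypothesis d0_metric : is_metric d0.
Hypothesis d1_metric : is_metric d1.
Hypothesis r_gt0 : forall x, 0 < r x.

Lemma tu_weight_ge0 u v : 0 <= tu_weight d0 d1 r u v.
Proof.
have [d0_ge0 _ _ _] := d0_metric; have [d1_ge0 _ _ _] := d1_metric.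
by rewrite /tu_weight; case: ifP => _; [case: ifP|exact: ltW].
Qed.

Lemma tu_connected (u v : M * 'F_2) :
  exists2 p, path (@tu_edge M) u p & last u p = v.
Proof.
exists [:: (v.1, u.2); v]; last by case: v.
by rewrite /= /tu_edge /= !eqxx orbT.
Qed.

Lemma twisted_union_dist_same u v : u.2 = v.2 ->
  twisted_union_dist d0 d1 r u v <= (if u.2 == 0 then d0 else d1) u.1 v.1.
Proof.
move=> uv; apply: le_trans.
  apply: (@shortest_path_dist_le _ _ _ _ tu_weight_ge0 _ _ [:: v]) => //.
  by rewrite /= /tu_edge uv eqxx.
rewrite walk_length_cons walk_length_nil addr0 /tu_weight uv eqxx.
by case: ifP.
Qed.

(** Two walks compete, changing layer at the end or at the start; one of them uses [d0] and the
    other [d1]. *)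
Lemma twisted_union_dist_cross u v : u.2 != v.2 ->
  twisted_union_dist d0 d1 r u v
    <= Num.min (d0 u.1 v.1) (d1 u.1 v.1) + r u.1 + r v.1.
Proof.
move=> uv; have ru := r_gt0 u.1; have rv := r_gt0 v.1.
have Du : twisted_union_dist d0 d1 r u v
    <= (if u.2 == 0 then d0 else d1) u.1 v.1 + r v.1.
  apply: le_trans.
    apply: (@shortest_path_dist_le _ _ _ _ tu_weight_ge0 _ _ [:: (v.1, u.2); v]).
      by rewrite /= /tu_edge /= !eqxx orbT.
    by [].
  rewrite !walk_length_cons walk_length_nil addr0 /tu_weight /= eqxx (negbTE uv).
  by case: ifP.
have Dv : twisted_union_dist d0 d1 r u v
    <= r u.1 + (if v.2 == 0 then d0 else d1) u.1 v.1.
  apply: le_trans.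
    apply: (@shortest_path_dist_le _ _ _ _ tu_weight_ge0 _ _ [:: (u.1, v.2); v]).
      by rewrite /= /tu_edge /= !eqxx orbT.
    by [].
  rewrite !walk_length_cons walk_length_nil addr0 /tu_weight /= eqxx (negbTE uv).
  by case: ifP.
move: uv Du Dv; rewrite eq_F2; case: (u.2 == 0); case: (v.2 == 0) => //= _;
  case: (leP (d0 u.1 v.1) (d1 u.1 v.1)); lra.
Qed.

End TwistedUnionBounds.

Theorem theorem5p1 (R : realType) (C0 C1 C2 L : R)
    (hC0 : 1 <= C0) (hC1 : 1 <= C1) (hC2 : 1 <= C2) (hL : 0 < L) :
  exists D : R,
    forall (M : finType) (d0 d1 : M -> M -> R) (r : M -> R),
      is_metric d0 -> is_metric d1 ->
      (forall x, 0 < r x) ->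
      (forall x y, `|d0 x y - d1 x y| <= r x + r y) ->
      (forall x y, `|r x - r y| <= d0 x y + d1 x y) ->
      (forall x y, `|r x - r y| <= L * Num.min (d0 x y) (d1 x y)) ->
      c1_le (fun x y => Num.min (d0 x y) (r x + r y)) C0 ->
      c1_le (fun x y => Num.min (d1 x y) (r x + r y)) C1 ->
      c1_le (fun x y => Num.min (d0 x y) (d1 x y)) C2 ->
      embeds_in_L1 (twisted_union_dist d0 d1 r) D.
Proof.
(* The summands pay for the h-coordinates, the variation of r, and the truncated l_1 maps. *)
pose B := C2 + 3 / 2 * L + 2 * (C0 + C1).
have B1 : 1 <= B by rewrite /B; lra.
(* Bound on an edge within a layer: d is d_i, m is h, g is d_i truncated, f and f2 are the cut
   distances for g and h, e is |r(x) - r(y)|, and t is the l_1 part. *)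
have upper (d m g f f2 e t C : R) : 0 <= d -> m <= d -> g <= d ->
    e <= L * m -> f <= C * g -> f2 <= C2 * m -> 1 <= C <= C0 + C1 ->
    t <= 3 / 2 * e + 2 * f -> f2 + t <= B * d.
  move=> dge0 md gd eLm fCg f2C /andP[C_ge1 CC].
  have Lmd : L * m <= L * d by rewrite ler_wpM2l// ltW.
  have C2md : C2 * m <= C2 * d by rewrite ler_wpM2l//; lra.
  have Cgd : C * g <= C * d by rewrite ler_wpM2l//; lra.
  have CCd : C * d <= (C0 + C1) * d by rewrite ler_wpM2r.
  by rewrite /B; lra.
exists (B / 8^-1) => M d0 d1 r md0 md1 r0 d01 _ rL.
move=> /c1_le_cut_dist[w0 w0_ge0 w0P] /c1_le_cut_dist[w1 w1_ge0 w1P].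
move=> /c1_le_cut_dist[w2 w2_ge0 w2P].
have [t0 [t0r t0P]] := truncated_l1 w0_ge0 r0.
have [t1 [t1r t1P]] := truncated_l1 w1_ge0 r0.
have [d0_ge0 d0_eq0 _ _] := md0; have [d1_ge0 d1_eq0 _ _] := md1.
have rhoE := tu_rhoE w2_ge0 t0r t1r.
(* If d_i <= r(x) + r(y), the l_1 part suffices. Otherwise |d_0 - d_1| <= r(x) + r(y) gives d_i <= h
   + r(x) + r(y). *)
have lower_same (u v : M * 'F_2) : u.2 = v.2 ->
    (if u.2 == 0 then d0 else d1) u.1 v.1 <= 8 * tu_rho w2 t0 t1 u v.
  move=> uv; rewrite rhoE uv eqxx; move: u.1 v.1 => x y.
  have /andP[w2l _] := w2P x y; have := d01 x y; rewrite ler_norml => /andP[? ?].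
  have := d0_ge0 x y; have := d1_ge0 x y; have := r0 x; have := r0 y.
  case: ifP => _.
  - have /andP[+ _] := t0P x y; have /andP[+ _] := w0P x y.
    move: w2l; case: (leP (d0 x y) (d1 x y)) => ?;
    case: (leP (d0 x y) (r x + r y)) => ?;
    case: (leP (r x + r y) (cut_dist w0 x y)); lra.
  - have /andP[+ _] := t1P x y; have /andP[+ _] := w1P x y.
    move: w2l; case: (leP (d0 x y) (d1 x y)) => ?;
    case: (leP (d1 x y) (r x + r y)) => ?;
    case: (leP (r x + r y) (cut_dist w1 x y)); lra.
have lower_cross (u v : M * 'F_2) : u.2 != v.2 ->
    Num.min (d0 u.1 v.1) (d1 u.1 v.1) + r u.1 + r v.1 <= 2 * tu_rho w2 t0 t1 u v.
  move=> uv; rewrite rhoE (negbTE uv); move: u.1 v.1 => x y.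
  have /andP[+ _] := w2P x y; have : 0 <= Num.min (d0 x y) (d1 x y).
    by rewrite le_min d0_ge0 d1_ge0.
  lra.
apply: (@embeds_in_L1_of_seq _ _ _ (tu_coords w2 t0 t1)).
- by rewrite invr_gt0.
- lra.
- move=> u v; rewrite -/(tu_rho w2 t0 t1 u v) => rho0.
  (* Positivity of r excludes points in different layers; within a layer d_i vanishes. *)
  have [uv|uv] := eqVneq u.2 v.2; last first.
    have := lower_cross u v uv; rewrite rho0 mulr0 leNgt => /negP[].
    by rewrite ltr_wpDl// addr_ge0 ?le_min ?d0_ge0 ?d1_ge0// ltW.
  have := lower_same u v uv; rewrite rho0 mulr0 => d_le0.
  suff uv1 : u.1 = v.1 by case: u v uv uv1 {rho0 d_le0} => ? ? [? ?] /= -> ->.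
  move: d_le0; case: ifP => _ d_le0; [apply/d0_eq0|apply/d1_eq0];
    by apply/eqP; rewrite eq_le d_le0 ?d0_ge0 ?d1_ge0.
- move=> u v; rewrite -/(tu_rho w2 t0 t1 u v); apply/andP; split.
    rewrite ler_pdivrMl//; have [uv|uv] := eqVneq u.2 v.2.
      exact: le_trans (twisted_union_dist_same md0 md1 r0 uv) (lower_same u v uv).
    apply: le_trans (twisted_union_dist_cross md0 md1 r0 uv) _.
    apply: le_trans (lower_cross u v uv) _.
    by rewrite ler_wpM2r ?sumr_ge0//; lra.
  apply: le_shortest_path_dist.
  + lra.
  + exact: tu_rho0.
  + exact: tu_rhoD.
  + move=> a b; rewrite /tu_edge rhoE /tu_weight.
    case: eqP => [_ _|_ /= /eqP ->].
      move: a.1 b.1 => x y.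
      have /andP[_ w2u] := w2P x y; have {}rL := rL x y.
      case: ifP => _.
        have /andP[_ w0u] := w0P x y; have /andP[_ t0u] := t0P x y.
        apply: upper (d0_ge0 x y) _ _ rL w0u w2u _ t0u; rewrite ?ge_min ?lexx//.
        by apply/andP; split; lra.
      have /andP[_ w1u] := w1P x y; have /andP[_ t1u] := t1P x y.
      apply: upper (d1_ge0 x y) _ _ rL w1u w2u _ t1u;
        rewrite ?ge_min ?lexx ?orbT//.
      by apply/andP; split; lra.
    (* On an edge between layers the image distance is exactly r(x), and B >= 1. *)
    have -> : cut_dist w2 b.1 b.1 = 0.
      by apply: big1 => A _; rewrite eqxx mulr0.
    by rewrite add0r -splitr ler_peMl// ltW.
  + exact: tu_connected.
Qed.
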